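(* Let $G$ be a finite graph (loops and parallel edges allowed). If $\mathrm{girth}(G)\ge 5$, then the bicircular matroid $B(G)$ has no positive double circuit.
   Context: The girth of $G$ is the length of a shortest cycle of $G$ (a loop is a cycle of length $1$, a pair of parallel edges a cycle of length $2$). The bicircular matroid $B(G)$ is the matroid on the edge set $E$ of $G$ whose independent sets are the edge sets $I\subseteq E$ such that every connected component of the subgraph $G[I]$ (edge set $I$, no isolated vertices) contains at most one cycle. A double circuit of a matroid with rank function $r$ is a set $D$ with $r(D)=|D|-2$ and $r(D-d)=r(D)$ for every $d\in D$; its circuit partition is the unique (up to order) partition $(D_1,\dots,D_k)$ of $D$ such that the circuits of the matroid contained in $D$ are exactly the sets $D\setminus D_i$. A class $D_i$ is singular if $|D_i|=1$ and multiple otherwise; $D$ is positive if its circuit partition has more singular classes than multiple classes. *)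

(* Defs.v *)
From mathcomp Require Import all_boot.

Set Implicit Arguments.
Unset Strict Implicit.
Unset Printing Implicit Defensive.

(* The order of the two components of [ends e] carries no meaning: it is
   forgotten by [joins], through which the ends of an edge are accessed. *)
Record multigraph := Multigraph {
  vertex : finType;
  edge : finType;
  ends : edge -> vertex * vertex
}.

Section Graph.
Variable G : multigraph.
Implicit Types (I C : {set edge G}) (e f : edge G) (v w : vertex G).

Definition joins e v w : bool :=
  (ends e == (v, w)) || (ends e == (w, v)).

(* [:: (v_0, e_0); ...; (v_(k-1), e_(k-1))], where e_i joins v_i to v_(i+1)
   with indices modulo k: for k = 1 this is a loop at v_0, and for k = 2 a pair
   of distinct parallel edges. *)
Definition cyclic_seq (p : seq (vertex G * edge G)) : bool :=
  [&& p != [::], uniq (map fst p), uniq (map snd p)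
    & cycle (fun x y => joins x.2 x.1 y.1) p].

(* Cycles are identified with their edge sets, so that rotations and reversals
   of a cyclic sequence give the same cycle, of length #|C|. *)
Definition is_cycle C : bool :=
  [exists p : #|C|.-tuple (vertex G * edge G),
     cyclic_seq p && (C == [set e in map snd p])].

(* [None] stands for the infinite girth of a graph without cycles. *)
Definition girth : option nat :=
  omap (fun C0 => #|[arg min_(C < C0 | is_cycle C) #|C|]|)
       [pick C | is_cycle C].

Definition girth_at_least (n : nat) : bool :=
  if girth is Some g then n <= g else true.

Definition adjacent I : rel (vertex G) :=
  fun v w => [exists e in I, joins e v w].

(* The edge set of the connected component of G[I] that contains e. *)
Definition component I e : {set edge G} :=
  [set f in I | connect (adjacent I) (ends e).1 (ends f).1].

Definition components I : {set {set edge G}} :=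
  [set component I e | e in I].

(* B(G) is represented by its family of independent sets. *)
Definition bicircular : pred {set edge G} :=
  fun I => [forall K in components I,
              #|[set C : {set edge G} | is_cycle C && (C \subset K)]| <= 1].

End Graph.

(* A matroid enters through its independence predicate; the notions below are
   the usual ones and do not mention the matroid axioms. *)
Section Matroid.
Variables (E : finType) (indep : pred {set E}).
Implicit Types (X C D : {set E}) (P : {set {set E}}).

Definition rank X : nat := \max_(I : {set E} | indep I && (I \subset X)) #|I|.

Definition circuit C : bool := minset (fun X => ~~ indep X) C.

(* r(D) = |D| - 2 is stated additively, as subtraction on nat is truncated. *)
Definition double_circuit D : Prop :=
  rank D + 2 = #|D| /\ (forall d, d \in D -> rank (D :\ d) = rank D).

Definition circuit_partition D P : Prop :=
  partition P D /\
  (forall C, (circuit C /\ C \subset D) <-> exists2 X, X \in P & C = D :\: X).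

Definition singular X : bool := #|X| == 1.

Definition positive D : Prop :=
  exists2 P, circuit_partition D P &
    #|[set X in P | ~~ singular X]| < #|[set X in P | singular X]|.

End Matroid.

(* Main.v *)
(* Write V(I) for the vertices met by I. Independent sets satisfy |I| <= |V(I)|
   and circuits |C| > |V(C)|; hence circuits have minimum degree 2, and a double
   circuit D has |D| <= |V(D)| + 2, so that by the handshake lemma at most four
   vertices of V(D) have degree at least 3. Deleting a singular class leaves a
   circuit, so both ends of a singular edge are such vertices. The girth
   therefore makes the set S of singular edges a forest, and 1 <= |S| <= 3.
   If there were at most one multiple class, S would contain a circuit. If there
   were exactly two, A and B, then D - A and D - B would be circuits with union D
   and intersection S, and |V(S)| > |S| would give |D| >= |V(D)| + 3. *)

Require Import Defs.
From mathcomp Require Import all_boot.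
From mathcomp Require Import zify.

Set Implicit Arguments.
Unset Strict Implicit.
Unset Printing Implicit Defensive.

Section Multigraph.
Variable G : multigraph.
Implicit Types (I J C D : {set edge G}) (e f : edge G) (v w x y : vertex G).

(** * Incidence, supports and adjacency *)

Definition incident e v : bool := (v == (ends e).1) || (v == (ends e).2).

Definition support I : {set vertex G} := [set v | [exists e in I, incident e v]].

(** A loop counts once, so the degree sum can fall short of twice the number of edges. *)
Definition degree I v : nat := #|[set e in I | incident e v]|.

Definition acyclic I : Prop := forall C, is_cycle C -> ~~ (C \subset I).

Lemma supportP I v : reflect (exists2 e, e \in I & incident e v) (v \in support I).
Proof. by rewrite inE; apply: exists_inP. Qed.

Lemma support_ends1 I e : e \in I -> (ends e).1 \in support I.
Proof. by move=> eI; apply/supportP; exists e; rewrite // /incident eqxx. Qed.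

Lemma support_sub I J : I \subset J -> support I \subset support J.
Proof.
move=> IJ; apply/subsetP=> v /supportP[e eI ev].
by apply/supportP; exists e => //; apply: (subsetP IJ).
Qed.

Lemma joinsC e v w : joins e v w = joins e w v.
Proof. by rewrite /joins orbC. Qed.

Lemma joins_ends e : joins e (ends e).1 (ends e).2.
Proof. by rewrite /joins -surjective_pairing eqxx. Qed.

Lemma joins_incident e v w : joins e v w -> incident e v.
Proof. by case/orP=> /eqP ee; rewrite /incident ee eqxx ?orbT. Qed.

Lemma adjacent_sym I : symmetric (adjacent I).
Proof.
by move=> v w; apply: eq_existsb => e; rewrite joinsC.
Qed.

Lemma connect_adjacentC I : connect_sym (adjacent I).
Proof. exact/sym_connect_sym/adjacent_sym. Qed.

Lemma adjacentI I e v w : e \in I -> joins e v w -> adjacent I v w.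
Proof. by move=> eI ev; apply/exists_inP; exists e. Qed.

Lemma connect_adjacentS I J v w :
  I \subset J -> connect (adjacent I) v w -> connect (adjacent J) v w.
Proof.
move=> IJ; apply: connect_sub => {}v {}w /exists_inP[e eI ev].
by apply/connect1/(adjacentI (subsetP IJ _ eI)).
Qed.

Lemma connect_incident I e v :
  e \in I -> incident e v -> connect (adjacent I) (ends e).1 v.
Proof.
move=> eI /orP[]/eqP-> //.
exact/connect1/(adjacentI eI)/joins_ends.
Qed.

(** * Cycles and connectivity *)

Lemma cyclic_seq_is_cycle (p : seq (vertex G * edge G)) :
  cyclic_seq p -> is_cycle [set e in map snd p].
Proof.
move=> cp; have [_ _ up _] := and4P cp.
have sp : size p == #|[set e in map snd p]|.
  by rewrite cardsE (card_uniqP up) size_map.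
by apply/existsP; exists (Tuple sp); rewrite /= cp eqxx.
Qed.

(** Edges chosen along a simple path are distinct: the edge leaving [v] meets [v], while the fourth
    clause, applied to the tail, keeps later edges away from [v]. The last clause lets the pairs be
    spliced into a cyclic sequence. *)
Lemma uniq_path_edges J v p :
  path (adjacent J) v p -> uniq (v :: p) ->
  exists q : seq (vertex G * edge G),
    [/\ map fst q = belast v p, uniq (map snd q), {subset map snd q <= J},
        forall e x, e \in map snd q -> incident e x -> x \in v :: p
      & forall a b, joins a.2 a.1 v -> b.1 = last v p ->
          path (fun s t => joins s.2 s.1 t.1) a (rcons q b)].
Proof.
elim: p v => [|w p IHp] v.
  by exists [::]; split=> // a b av /= ->; rewrite andbT.
case/andP=> /exists_inP[e eJ evw] wp /andP[vp up].
have [q [qp uq qJ qv qpath]] := IHp w wp up.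
exists ((v, e) :: q); split=> /=.
- by rewrite qp.
- rewrite uq andbT; apply: contra vp => eq; apply: qv eq _.
  exact: joins_incident evw.
- by move=> f; rewrite inE => /predU1P[-> | /qJ].
- move=> f x; rewrite inE => /predU1P[-> | fq fx].
    case/orP: evw => /eqP ee; rewrite /incident ee /= !inE.
      by case/orP=> ->; rewrite ?orbT.
    by case/orP=> ->; rewrite ?orbT.
  by rewrite inE (qv f) ?orbT.
- by move=> a b av bl; rewrite av /= qpath.
Qed.

(** A simple path between the ends of [e] that avoids [e] is closed up by [e]; for a loop the path
    is empty. *)
Lemma connect_cycle I e :
  e \in I -> connect (adjacent (I :\ e)) (ends e).1 (ends e).2 ->
  exists2 C, is_cycle C & C \subset I.
Proof.
move=> eI; rewrite connect_adjacentC => /connectP[p0 /shortenP[p pp up _] {p0} lp].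
have [q [qp uq qI _ qpath]] := uniq_path_edges pp up.
exists [set f in map snd (((ends e).1, e) :: q)].
  apply: cyclic_seq_is_cycle; apply/and4P; split=> //=.
  - by rewrite qp lp -rcons_uniq -lastI.
  - by rewrite uq andbT; apply/negP=> /qI; rewrite !inE eqxx.
  - by rewrite qpath //=; apply: joins_ends.
apply/subsetP=> f; rewrite !inE => /predU1P[-> // | /qI].
by rewrite inE => /andP[].
Qed.

(** The edge [a.2] need not lie in [J]: this allows walking round a cyclic sequence without its
    first edge. *)
Lemma path_connect J (q : seq (vertex G * edge G)) a b :
  path (fun s t => joins s.2 s.1 t.1) a (rcons q b) -> {subset map snd q <= J} ->
  exists2 w, joins a.2 a.1 w & connect (adjacent J) w b.1.
Proof.
elim: q a => [|c q IHq] a /=; first by rewrite andbT => ab _; exists b.1.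
case/andP=> ac cq qJ; exists c.1 => //.
have [|w cw wb] := IHq c cq.
  by move=> f fq; apply: qJ; rewrite inE fq orbT.
apply: connect_trans wb; apply/connect1/(adjacentI _ cw).
by apply: qJ; rewrite inE eqxx.
Qed.

Lemma cycle_connect C I e :
  is_cycle C -> C \subset I -> e \in C ->
  connect (adjacent (I :\ e)) (ends e).1 (ends e).2.
Proof.
case/existsP=> p /andP[cp /eqP defC] CI; rewrite defC inE => /mapP[[v e'] vep /= ->] {e}.
have [_ _ up Rp] := and4P cp.
(* Rotation puts the chosen edge first; the rest [q] then connects its ends. *)
case/rot_to: (vep) => i q defq.
have uq : uniq (e' :: map snd q).
  by rewrite -[e' :: _]/(map snd ((v, e') :: q)) -defq map_rot rot_uniq.
move: Rp; rewrite -(rot_cycle i) defq /=.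
case/(path_connect (J := I :\ e')) => [f fq | w /= evw wv].
  rewrite in_setD1; apply/andP; split.
    by apply: contraTneq fq => ->; case/andP: uq.
  apply: (subsetP CI); rewrite defC inE -(mem_rot i) -map_rot defq.
  by rewrite inE fq orbT.
by case/orP: evw => /eqP -> //=; rewrite connect_adjacentC.
Qed.

Lemma cycle_card_support C : is_cycle C -> #|C| <= #|support C|.
Proof.
case/existsP=> p /andP[/and4P[_ uv _ Rp] /eqP defC].
rewrite -{1}(size_tuple p) -(size_map fst) -(card_uniqP uv).
apply/subset_leq_card/subsetP=> v /mapP[a ap ->].
apply/supportP; exists a.2; first by rewrite defC inE map_f.
exact: joins_incident (next_cycle Rp ap).
Qed.

Lemma cycle_neq0 C : is_cycle C -> C != set0.
Proof.
case/existsP=> p /andP[/and4P[]]; case: (tval p) => // -[v e] q _ _ _ _ /eqP->.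
by apply/set0Pn; exists e; rewrite !inE eqxx.
Qed.

Lemma girth_cycle n C : girth_at_least G n -> is_cycle C -> n <= #|C|.
Proof.
rewrite /girth_at_least /girth; case: pickP => [C0 C0c | noC _ Cc].
  rewrite /=; case: (arg_minnP (fun C : {set edge G} => #|C|) C0c) => C1 _ minC1.
  by move=> nC1 /minC1; apply: leq_trans.
by rewrite noC in Cc.
Qed.

(** * Number of components of the spanning subgraph, isolated vertices included *)

Definition ncomp I : nat := #|roots (adjacent I)|.

(** Induction along a walk: repeated passages through [e] can be cut short, so at most one crossing,
    in either direction, remains. *)
Lemma connect_add_edge I e v w :
  connect (adjacent (e |: I)) v w ->
  [\/ connect (adjacent I) v w,
      connect (adjacent I) v (ends e).1 /\ connect (adjacent I) (ends e).2 w
    | connect (adjacent I) v (ends e).2 /\ connect (adjacent I) (ends e).1 w].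
Proof.
case/connectP=> p; elim: p v => [|u p IHp] v /=; first by move=> _ ->; constructor 1.
case/andP=> /exists_inP[f] /setU1P[-> {f} | fI] fvu up lw; last first.
  have vu : connect (adjacent I) v u by apply/connect1/(adjacentI fI).
  case: (IHp u up lw) => [uw | [ux yw] | [uy xw]].
  - by constructor 1; apply: connect_trans uw.
  - by constructor 2; split=> //; apply: connect_trans ux.
  - by constructor 3; split=> //; apply: connect_trans uy.
case/orP: fvu => /eqP ee; move: (IHp u up lw); rewrite ee /=.
  case=> [uw | [ux yw] | [uy xw]].
  - by constructor 2.
  - by constructor 2.
  - by constructor 1.
case=> [uw | [ux yw] | [uy xw]].
- by constructor 3.
- by constructor 1.
- by constructor 3.
Qed.

Lemma mem_roots I v : (v \in roots (adjacent I)) = (root (adjacent I) v == v).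
Proof. by []. Qed.

Lemma root_root_sub I J v :
  I \subset J -> root (adjacent J) (root (adjacent I) v) = root (adjacent J) v.
Proof.
move=> IJ; apply/eqP; rewrite root_connect; last exact: connect_adjacentC.
by rewrite connect_adjacentC; apply: connect_adjacentS IJ (connect_root _ _).
Qed.

(** At most two components merge: the old roots other than [y], the root of the second end, have
    distinct new roots. *)
Lemma ncomp_add_edge_le I e : ncomp I <= (ncomp (e |: I)).+1.
Proof.
have cs J := connect_adjacentC J.
set y := root (adjacent I) (ends e).2.
rewrite /ncomp (cardD1 y) [_ \in roots _]roots_root // add1n ltnS.
rewrite -(@card_in_image _ _ (root (adjacent (e |: I))) [predD1 roots (adjacent I) & y]).
  apply/subset_leq_card/subsetP=> _ /imageP[v _ ->].
  exact: roots_root.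
have nc a : a \in [predD1 roots (adjacent I) & y] ->
    ~ connect (adjacent I) a (ends e).2.
  case/andP=> ay; rewrite mem_roots => /eqP aa.
  by rewrite -root_connect // aa; apply/negP.
move=> a b ay yb /eqP; rewrite root_connect // => /connect_add_edge.
move: (nc a ay) (nc b yb) => na nb.
case=> [ab | [_] | [/na //]]; last by rewrite cs => /nb.
case/andP: ay => _; case/andP: yb => _; rewrite !mem_roots => /eqP <- /eqP <-.
by apply/eqP; rewrite root_connect.
Qed.

(** Every new root is the image of an old root other than [y], because [x] can stand in for [y] once
    [e] ties their components together. *)
Lemma ncomp_add_edge_lt I e :
  ~~ connect (adjacent I) (ends e).1 (ends e).2 -> ncomp (e |: I) < ncomp I.
Proof.
have cs J := connect_adjacentC J.
set x := root (adjacent I) (ends e).1; set y := root (adjacent I) (ends e).2 => nxy.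
have II : I \subset e |: I by apply: subsetUr.
rewrite /ncomp (cardD1 y (roots (adjacent I))) [_ \in roots _]roots_root // add1n ltnS.
apply: leq_trans (leq_image_card (root (adjacent (e |: I))) _).
apply/subset_leq_card/subsetP=> v; rewrite mem_roots => /eqP vv.
have [vy | vy] := eqVneq (root (adjacent I) v) y; last first.
  apply/imageP; exists (root (adjacent I) v); last by rewrite root_root_sub.
  by rewrite inE vy /=; apply: roots_root.
apply/imageP; exists x.
  rewrite !inE /=; apply/andP; split; last exact: roots_root.
  by rewrite /x /y root_connect.
rewrite -[LHS]vv -(root_root_sub v II) vy /x /y !root_root_sub //.
apply/esym/eqP; rewrite root_connect //; apply/connect1/(adjacentI (setU11 _ _)).
exact: joins_ends.
Qed.

Lemma connect_isolated I v w :
  v \notin support I -> connect (adjacent I) v w -> w = v.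
Proof.
move=> vI /connectP[[|u p] //=]; case/andP=> /exists_inP[e eI evu]; case/negP: vI.
by apply/supportP; exists e => //; apply: joins_incident evu.
Qed.

Lemma root_isolated I v : v \notin support I -> root (adjacent I) v = v.
Proof. by move/connect_isolated; apply; apply: connect_root. Qed.

Lemma support0 : support (set0 : {set edge G}) = set0.
Proof. by apply/setP=> v; rewrite in_set0; apply/supportP=> -[e]; rewrite inE. Qed.

(** Without edges every vertex is a component, and each added edge removes at most one component. *)
Lemma card_vertex_le I : #|vertex G| <= #|I| + ncomp I.
Proof.
have [n] := ubnP #|I|; elim: n I => // n IHn I In.
have [-> | [e eI]] := set_0Vmem I.
  rewrite cards0 add0n; apply/subset_leq_card/subsetP=> v _.
  by rewrite mem_roots root_isolated // support0 inE.
have cI : #|I| = #|I :\ e|.+1 by rewrite (cardsD1 e I) eI.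
have := ncomp_add_edge_le (I :\ e) e; rewrite setD1K //.
by have := IHn (I :\ e); lia.
Qed.

Lemma acyclicS I J : I \subset J -> acyclic J -> acyclic I.
Proof. by move=> IJ aJ C /aJ; apply: contra => /subset_trans; apply. Qed.

(** In a forest each added edge does merge two components, since ends already connected would close
    a cycle. *)
Lemma acyclic_ncomp I : acyclic I -> #|I| + ncomp I <= #|vertex G|.
Proof.
have [n] := ubnP #|I|; elim: n I => // n IHn I In aI.
have [-> | [e eI]] := set_0Vmem I.
  by rewrite cards0; apply: max_card.
have cI : #|I| = #|I :\ e|.+1 by rewrite (cardsD1 e I) eI.
have := @ncomp_add_edge_lt (I :\ e) e; rewrite setD1K // => lt.
have := IHn (I :\ e); rewrite cI in In.
move=> /(_ In (acyclicS (subD1set I e) aI)).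
suff /lt : ~~ connect (adjacent (I :\ e)) (ends e).1 (ends e).2 by lia.
by apply/negP=> /(connect_cycle eI)[C /aI /negP].
Qed.

Lemma acyclic_card_support I : acyclic I -> I != set0 -> #|I| < #|support I|.
Proof.
move=> /acyclic_ncomp cI /set0Pn[e eI].
have cs := connect_adjacentC I.
set x := root (adjacent I) (ends e).1.
have xI : x \in support I.
  apply: contraLR (support_ends1 eI) => xI.
  by rewrite (connect_isolated (w := (ends e).1) xI) // cs connect_root.
(* Each vertex outside the support is its own root; the root [x] inside the support makes the final
   bound strict. *)
suff : #|x |: ~: support I| <= ncomp I.
  by rewrite cardsU1 inE xI; have := cardsC (support I); lia.
apply/subset_leq_card/subsetP=> v /setU1P[-> | ]; first exact: roots_root.
by rewrite inE mem_roots => /root_isolated ->.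
Qed.

Lemma connected_card C x :
  {in support C, forall v, connect (adjacent C) x v} ->
  ncomp C <= (#|~: support C|).+1.
Proof.
move=> Cx; have cs := connect_adjacentC C.
apply: leq_trans (_ : #|root (adjacent C) x |: ~: support C| <= _); last first.
  by rewrite cardsU1; case: (_ \notin _) => /=; lia.
apply/subset_leq_card/subsetP=> v; rewrite mem_roots => /eqP vv.
rewrite in_setU1 in_setC.
have [/Cx xv | _] := boolP (v \in support C); last by rewrite orbT.
by rewrite -[v in v == _]vv root_connect // cs xv.
Qed.

Lemma ncomp_cycle C I e :
  is_cycle C -> C \subset I -> e \in C -> ncomp (I :\ e) = ncomp I.
Proof.
move=> Cc CI eC; have exy := cycle_connect Cc CI eC.
have eI := subsetP CI e eC; have cs := connect_adjacentC (I :\ e).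
(* A root is a [pick] from its class, so equal classes have equal roots. *)
apply: eq_card => v; rewrite !mem_roots; congr (odflt v _ == v).
apply: eq_pick => w; apply/idP/idP; first exact/connect_adjacentS/subD1set.
rewrite -{1}(setD1K eI) => /connect_add_edge[// | [vx yw] | [vy xw]].
  exact: connect_trans vx (connect_trans exy yw).
by apply: connect_trans vy (connect_trans _ xw); rewrite cs.
Qed.

(** * Edge and vertex counts of independent sets and circuits *)

Lemma card_le_support I :
  #|[set C | is_cycle C & C \subset I]| <= 1 -> #|I| <= #|support I|.
Proof.
move/card_le1_eqP=> uC.
have ac_card J : acyclic J -> #|J| <= #|support J|.
  have [-> _ | J0 /acyclic_card_support/(_ J0)/ltnW //] := eqVneq J set0.
  by rewrite cards0.
case: (pickP [pred C | is_cycle C & C \subset I]) => [C /andP[Cc CI] | noC]; last first.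
  by apply: ac_card => C Cc; have := noC C; rewrite /= Cc /= => ->.
have /set0Pn[e eC] := cycle_neq0 Cc; have eI := subsetP CI e eC.
(* [C] is the only cycle in [I], so deleting its edge [e] leaves a forest. *)
have aI : acyclic (I :\ e).
  move=> C' Cc'; apply/negP=> /subsetD1P[CI' /negP[]].
  by rewrite (uC C C') // inE ?Cc ?Cc'.
(* The strict forest bound requires an edge; if none remains, one end of [e] suffices. *)
have [I0 | I0] := eqVneq (I :\ e) set0; rewrite (cardsD1 e I) eI.
  rewrite I0 cards0 card_gt0; apply/set0Pn.
  by exists (ends e).1; apply: support_ends1.
apply: leq_trans (acyclic_card_support aI I0) _.
exact/subset_leq_card/support_sub/subD1set.
Qed.

(** Edges and vertices are grouped by the root of their component, and the bound for at most one
    cycle is summed over the components. *)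
Lemma bicircular_card_support I : bicircular I -> #|I| <= #|support I|.
Proof.
move/forall_inP=> bI; set rt := root (adjacent I).
have cs := connect_adjacentC I.
rewrite -!sum1_card (partition_big (fun e => rt (ends e).1) predT) //=.
rewrite [leqRHS](partition_big rt predT) //=; apply: leq_sum => r _.
rewrite !sum1dep_card; set K := [set e | _].
have [-> | [e eK]] := set_0Vmem K; first by rewrite cards0.
have [eI /eqP er] : e \in I /\ rt (ends e).1 == r.
  by apply/andP; rewrite inE in eK.
have defK : K = component I e.
  by apply/setP=> f; rewrite !inE -er /rt root_connect // cs.
have /card_le_support : #|[set C | is_cycle C & C \subset K]| <= 1.
  by apply: bI; rewrite defK; apply: imset_f.
move/leq_trans; apply; apply/subset_leq_card/subsetP=> v /supportP[f].
rewrite !inE => /andP[fI /eqP <-] fv; apply/andP; split.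
  by apply/exists_inP; exists f.
by rewrite /rt root_connect // cs connect_incident.
Qed.

Lemma acyclic_bicircular I : acyclic I -> bicircular I.
Proof.
move=> aI; apply/forall_inP=> _ /imsetP[e _ ->].
rewrite (_ : [set C | _ & _] = set0) ?cards0 //.
apply/setP=> C; rewrite in_set0 inE; apply/negP=> /andP[/aI/negP nCI CK]; apply: nCI.
by apply: subset_trans CK _; apply/subsetP=> f; rewrite inE => /andP[].
Qed.

(** Every edge of a walk starting at an end of [e] belongs to the component of [e]. *)
Lemma component_connect I e v :
  connect (adjacent I) (ends e).1 v ->
  connect (adjacent (component I e)) (ends e).1 v.
Proof.
suff: forall u, connect (adjacent I) (ends e).1 u -> connect (adjacent I) u v ->
  connect (adjacent (component I e)) u v by apply.
move=> u + /connectP[p]; elim: p u => [|w p IHp] u /= eu; first by move=> _ ->.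
case/andP=> /exists_inP[f fI fuw] wp lv.
have uw := adjacentI fI fuw.
apply: connect_trans (IHp w _ wp lv); last exact: connect_trans eu (connect1 uw).
apply/connect1/(adjacentI _ fuw); rewrite inE fI; apply: connect_trans eu _.
by rewrite connect_adjacentC connect_incident // (joins_incident fuw).
Qed.

Lemma component_idem I e : component (component I e) e = component I e.
Proof.
apply/setP=> f; rewrite inE; apply/andP/idP => [[] // | fK]; split=> //.
by apply: component_connect; move: fK; rewrite inE => /andP[].
Qed.

(* A circuit is connected and contains two cycles, so one edge can be deleted
   from each of them without disconnecting it. *)
Lemma circuit_card_support C : circuit (@bicircular G) C -> #|support C| < #|C|.
Proof.
case/minsetP=> /forall_inPn[_ /imsetP[e eC ->]]; rewrite -ltnNge => K2 minC.
have KC : component C e \subset C by apply/subsetP=> f; rewrite inE => /andP[].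
have eK : e \in component C e by rewrite inE eC /=.
(* A component with two cycles is its own component, hence dependent; minimality makes it all of
   [C], so [C] is connected. *)
have defC : component C e = C.
  apply: minC => //; apply/forall_inPn; exists (component C e).
    by rewrite -{1}component_idem; apply: imset_f.
  by rewrite -ltnNge.
rewrite defC in K2 => {KC eK minC}.
have connC : ncomp C <= (#|~: support C|).+1.
  apply: (connected_card (x := (ends e).1)) => v /supportP[f fC fv].
  apply: connect_trans (connect_incident fC fv).
  by move: fC; rewrite -{1}defC inE => /andP[].
(* Two distinct cycles are ordered so that the first has an edge [e1] outside the second; [C2] then
   survives the deletion of [e1]. *)
have [C1 [C2 [e1 [Cc1 CC1 Cc2 CC2 [eC1 eC2]]]]] :
    exists C1 C2 e1, [/\ is_cycle C1, C1 \subset C, is_cycle C2, C2 \subset C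
      & e1 \in C1 /\ e1 \notin C2].
  case/card_gt1P: K2 => C1 [C2 []]; rewrite !inE => /andP[Cc1 CC1] /andP[Cc2 CC2].
  rewrite eqEsubset negb_and => /orP[]/subsetPn[e1 e1C1 e1C2].
    by exists C1, C2, e1.
  by exists C2, C1, e1.
have /set0Pn[e2 e2C2] := cycle_neq0 Cc2.
have CC2' : C2 \subset C :\ e1 by rewrite subsetD1 CC2.
have := card_vertex_le (C :\ e1 :\ e2).
rewrite (ncomp_cycle Cc2) // (ncomp_cycle Cc1) //.
have := cardsD1 e1 C; have := cardsD1 e2 (C :\ e1); have := cardsC (support C).
by rewrite (subsetP CC1 _ eC1) (subsetP CC2' _ e2C2); lia.
Qed.

(** * Degrees and the handshake lemma *)

Lemma degree_sub I J v : I \subset J -> degree I v <= degree J v.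
Proof.
move=> IJ; apply/subset_leq_card/subsetP=> e; rewrite !inE => /andP[/(subsetP IJ)->].
by [].
Qed.

Lemma degreeD1 I e v :
  e \in I -> incident e v -> degree I v = (degree (I :\ e) v).+1.
Proof.
move=> eI ev; rewrite /degree (cardsD1 e) !inE eI ev add1n; congr _.+1.
by apply: eq_card => f; rewrite !inE andbA.
Qed.

Lemma degree_gt0 I v : (0 < degree I v) = (v \in support I).
Proof.
rewrite card_gt0; apply/set0Pn/supportP=> [[e] | [e eI ev]].
  by rewrite inE => /andP[]; exists e.
by exists e; rewrite inE eI.
Qed.

(** If [e] were the only edge at [v], the independent set [C :\ e] would miss [v], and its bound
    would give [#|C| <= #|support C|], false for a circuit. *)
Lemma circuit_degree C v :
  circuit (@bicircular G) C -> v \in support C -> 1 < degree C v.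
Proof.
move=> cC vC; have /minsetP[_ minC] := cC.
have /supportP[e eC ev] := vC.
rewrite (degreeD1 eC ev) ltnS degree_gt0; apply/negPn/negP=> vCe.
have /bicircular_card_support : bicircular (C :\ e).
  apply/negPn/negP=> /minC/(_ (subD1set C e)) eqC.
  by move: eC; rewrite -eqC setD11.
have sub : support (C :\ e) \subset support C :\ v.
  by rewrite subsetD1 vCe support_sub ?subD1set.
have := subset_leq_card sub; have := circuit_card_support cC.
by rewrite (cardsD1 v (support C)) vC (cardsD1 e C) eC; lia.
Qed.

Lemma rank_le_support D : rank (@bicircular G) D <= #|support D|.
Proof.
apply/bigmax_leqP=> I /andP[/bicircular_card_support/leq_trans + ID].
by apply; apply/subset_leq_card/support_sub.
Qed.

Lemma sum_degree_le D : \sum_(v in support D) degree D v <= 2 * #|D|.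
Proof.
under eq_bigr do rewrite /degree -sum1dep_card big_mkcondr /=.
rewrite exchange_big /= mulnC -sum_nat_const; apply: leq_sum => e eD.
rewrite -big_mkcondr sum1dep_card.
apply: leq_trans (_ : #|[set (ends e).1; (ends e).2]| <= 2); last first.
  by rewrite cards2; case: eqP.
by apply/subset_leq_card/subsetP=> v; rewrite !inE => /andP[].
Qed.

(** In the degree sum every vertex of the support contributes at least 2, and those of [B] at least
    one more. *)
Lemma card_branch_le D (B : {set vertex G}) :
  B \subset support D -> {in support D, forall v, 1 < degree D v} ->
  {in B, forall v, 2 < degree D v} -> 2 * #|support D| + #|B| <= 2 * #|D|.
Proof.
move=> BD deg2 deg3; apply: leq_trans (sum_degree_le D).
rewrite mulnC -sum_nat_const -sum1_card -[in X in _ + X <= _](setIidPr BD).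
under [X in _ + X <= _]eq_bigl do rewrite inE.
rewrite big_mkcondr -big_split /=; apply: leq_sum => v vD.
by case: ifP => [/deg3 | _]; rewrite ?addn1 ?addn0 ?deg2.
Qed.

End Multigraph.

(** * Double circuits in graphs of girth at least five *)

Theorem theorem8 (G : multigraph) (hgirth : girth_at_least G 5) :
  ~ exists D : {set edge G},
      double_circuit (@bicircular G) D /\ positive (@bicircular G) D.
Proof.
case=> D [[rD _] [P [partP circP]]].
have cardD : #|D| <= #|support D| + 2 by rewrite -rD leq_add2r rank_le_support.
have [/eqP coverP trivP _] := and3P partP.
set mP := [set X in P | _]; set sP := [set X in P | _] => pos.
have circ X : X \in P -> circuit (@bicircular G) (D :\: X).
  by move=> XP; apply: (proj1 ((circP _).2 _)); exists X.
have inP d : d \in D -> exists2 X, X \in P & d \in X.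
  by rewrite -coverP => /bigcupP[X]; exists X.
have disjP X Y d : X \in P -> Y \in P -> d \in X -> d \in Y -> X = Y.
  by move=> XP YP dX dY; rewrite -(def_pblock trivP XP dX) (def_pblock trivP YP dY).
have subP X : X \in P -> X \subset D.
  by move=> XP; rewrite -coverP; apply: bigcup_sup.
set S := cover sP.
have SP e : e \in S -> [set e] \in P.
  case/bigcupP=> X; rewrite inE => /andP[XP /cards1P[x defX]] eX.
  by move: eX XP; rewrite defX inE => /eqP->.
have SD : S \subset D by apply/subsetP=> e /SP/subP; rewrite sub1set.
have cardS : #|S| = #|sP|.
  have trivS : trivIset sP.
    by apply: trivIsetS trivP; apply/subsetP=> X; rewrite inE => /andP[].
  rewrite -(eqP trivS) -sum1_card; apply: eq_bigr => X.
  by rewrite inE => /andP[_ /eqP].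
have S0 : S != set0 by rewrite -card_gt0 cardS; apply: leq_ltn_trans pos.
have SmP X : X \in mP -> S \subset D :\: X.
  rewrite inE => /andP[XP nX]; apply/subsetP=> e eS; rewrite inE (subsetP SD) // andbT.
  apply: contra nX => eX.
  by rewrite -(disjP _ _ e (SP e eS) XP (set11 e) eX) /singular cards1.
have DS d : d \in D -> d \notin S -> exists2 X, X \in mP & d \in X.
  case/inP=> X XP dX dS; exists X => //; rewrite inE XP /=.
  by apply: contra dS => sX; apply/bigcupP; exists X; rewrite // inE XP.
(* An edge [e] at [v] in class [X] survives in the circuit [D :\: Y] for any other class [Y]; one
   exists because the circuit [D :\: X] is nonempty. *)
have deg2 : {in support D, forall v, 1 < degree D v}.
  move=> v /supportP[e eD ev]; have [X XP eX] := inP e eD.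
  have /set0Pn[d] : D :\: X != set0.
    by rewrite -card_gt0; apply: leq_ltn_trans (circuit_card_support (circ X XP)).
  rewrite inE => /andP[dX dD]; have [Y YP dY] := inP d dD.
  apply: leq_trans (degree_sub v (subsetDl D Y)).
  apply: circuit_degree (circ Y YP) _; apply/supportP; exists e => //.
  rewrite inE eD andbT; apply: contra dX => eY.
  by rewrite (disjP _ _ _ XP YP eX eY).
(* Without the singular edge [e] a circuit remains; by [deg2] it still meets [v], hence has degree
   at least 2 there. *)
have deg3 : {in support S, forall v, 2 < degree D v}.
  move=> v /supportP[e eS ev]; have eD := subsetP SD e eS.
  have vD : v \in support D by apply/supportP; exists e.
  have := deg2 v vD; rewrite (degreeD1 eD ev) !ltnS degree_gt0.
  exact/circuit_degree/circ/SP.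
(* The 4 is twice the excess 2 of [cardD], since the degree count is doubled. *)
have cardB : #|support S| <= 4.
  by have := card_branch_le (support_sub SD) deg2 deg3; lia.
(* A cycle in [S] would need at least 5 vertices of [support S]. *)
have aS : acyclic S.
  move=> C Cc; apply/negP=> /support_sub/subset_leq_card.
  by have := girth_cycle hgirth Cc; have := cycle_card_support Cc; lia.
have ltS := acyclic_card_support aS S0.
have noSub X : X \in P -> ~~ (D :\: X \subset S).
  move=> /circ/minsetP[nb _]; apply: contra nb => sub.
  exact/acyclic_bicircular/(acyclicS sub).
(* [#|mP| < #|sP| = #|S| < #|support S| <= 4]. *)
have : #|mP| <= 2 by lia.
rewrite leq_eqVlt ltnS => /orP[/cards2P[A [B [AB defm]]] | /card_le1_eqP m1].
  have [Am Bm] : A \in mP /\ B \in mP by rewrite defm !inE !eqxx orbT.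
  have [AP BP] : A \in P /\ B \in P.
    by move: Am Bm; rewrite !inE => /andP[-> _] /andP[-> _].
  have AUB : (D :\: A) :|: (D :\: B) = D.
    rewrite -setDIr; apply/setDidPl; rewrite -setI_eq0.
    apply/eqP/setP=> d; rewrite !inE; apply/and3P=> -[_ dA dB].
    by rewrite (disjP _ _ _ AP BP dA dB) eqxx in AB.
  have AIB : (D :\: A) :&: (D :\: B) \subset S.
    apply/subsetP=> d; rewrite !inE => /andP[/andP[dA dD] /andP[dB _]].
    apply/negPn/negP=> /(DS d dD)[X]; rewrite defm !inE => /orP[]/eqP-> dX.
      by rewrite dX in dA.
    by rewrite dX in dB.
  have sU : support D \subset support (D :\: A) :|: support (D :\: B).
    apply/subsetP=> v; rewrite -{1}AUB => /supportP[e /setUP[] eD ev]; apply/setUP.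
      by left; apply/supportP; exists e.
    by right; apply/supportP; exists e.
  have sI : support S \subset support (D :\: A) :&: support (D :\: B).
    by rewrite subsetI !support_sub ?SmP.
  (* The two circuits have together at least [#|support D| + #|support S| + 2] edges, counted twice
     on their intersection, which lies in [S]. With [ltS] this contradicts [cardD]. *)
  have := circuit_card_support (circ A AP); have := circuit_card_support (circ B BP).
  have := subset_leq_card sU; have := subset_leq_card sI; have := subset_leq_card AIB.
  have := cardsUI (D :\: A) (D :\: B); rewrite AUB.
  by have := cardsUI (support (D :\: A)) (support (D :\: B)); lia.
(* With no multiple class, deleting any singular edge leaves a circuit inside [S]; with a single one
   [X], the circuit [D :\: X] lies in [S]. *)
have [m0 | [X Xm]] := set_0Vmem mP.
  case/set0Pn: S0 => e /SP/noSub/negP; apply; apply/subsetP=> d /setDP[dD _].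
  by apply/negPn/negP=> /(DS d dD)[X]; rewrite m0 inE.
have /noSub/negP : X \in P by move: Xm; rewrite inE => /andP[].
apply; apply/subsetP=> d /setDP[dD dX].
apply/negPn/negP=> /(DS d dD)[Y Ym dY].
by rewrite (m1 Y X Ym Xm) dY in dX.
Qed.
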